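(* Let $s\in(0,T)$, $\mu\in\mathscr{P}_2(\mathbb{R}^d)$, $r>0$, $\varepsilon\ge0$, and let $\phi:(s-r,s+r)\times\mathbb{B}_r(\mu)\to\mathbb{R}\cup\{\pm\infty\}$ be finite at $(s,\mu)$. If $(a,\gamma)\in\partial^-_{P,\varepsilon}\phi(s,\mu)$, then $(a,\mathrm{b}[\gamma])\in\partial^-_{D,\varepsilon}\phi(s,\mu)$. Similarly, if $(a,\gamma)\in\partial^+_{P,\varepsilon}\phi(s,\mu)$, then $(a,\mathrm{b}[\gamma])\in\partial^+_{D,\varepsilon}\phi(s,\mu)$.
   Context: $\mathscr{P}_2(X)$ is the space of Borel probability measures on $X$ with finite second moment, with the 2-Wasserstein metric $W_2$. $\mathbb{R}^{d*}$ denotes row vectors. $\mathscr{L}_2(\mu)$ (resp. $\mathscr{L}_2^*(\mu)$) is the space of $\mu$-square-integrable maps $\mathbb{R}^d\to\mathbb{R}^d$ (resp. $\mathbb{R}^d\to\mathbb{R}^{d*}$), $\langle p,v\rangle_\mu:=\int p(x)v(x)\mu(dx)$, $\|(\theta,v)\|:=(\theta^2+\|v\|_{\mathscr{L}_2(\mu)}^2)^{1/2}$. $h\sharp m$ is the push-forward; $\mathrm{p}^i,\mathrm{p}^{i,j}$ are coordinate projections; $\|\pi\|:=(\int|x_1-x_2|^2\pi(d(x_1,x_2)))^{1/2}$. $\mathbb{B}_\alpha(\cdot)$ are closed balls; $\mathbb{R}\times\mathscr{P}_2(\mathbb{R}^d)$ carries the metric $(|t-s|^2+W_2^2(\nu,\mu))^{1/2}$.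 **Directional $\varepsilon$-differentials.** $\partial^-_{D,\varepsilon}\phi(s,\mu)$ is the set of $(a,p)\in\mathbb{R}\times\mathscr{L}_2^*(\mu)$ such that for every $(\theta,v)\in\mathbb{R}\times\mathscr{L}_2(\mu)$ $$\liminf_{h\downarrow0,(\theta',v')\to(\theta,v)}\tfrac1h\big[\phi(s+h\theta',(\mathrm{Id}+hv')\sharp\mu)-\phi(s,\mu)-h(a\theta'+\langle p,v'\rangle_\mu)\big]\ge-\varepsilon\|(\theta,v)\|;$$ $\partial^+_{D,\varepsilon}\phi(s,\mu)$ is the set of $(a,p)$ for which, for every $(\theta,v)$, the corresponding $\limsup$ is $\le\varepsilon\|(\theta,v)\|$. **Proximal $\varepsilon$-differentials.** $\partial^-_{P,\varepsilon}\phi(s,\mu)$ is the set of $(a,\gamma)\in\mathbb{R}\times\mathscr{P}_2(\mathbb{R}^d\times\mathbb{R}^{d*})$ with $\mathrm{p}^1\sharp\gamma=\mu$ for which there are $\alpha\in(0,r]$, $\sigma\ge0$ such that for every $(t,\nu)\in\mathbb{B}_\alpha(s,\mu)$ in the domain of $\phi$ and every $\beta\in\mathscr{P}_2(\mathbb{R}^d\times\mathbb{R}^d\times\mathbb{R}^{d*})$ with $\mathrm{p}^{1,3}\sharp\beta=\gamma$, $\mathrm{p}^2\sharp\beta=\nu$: $$\phi(t,\nu)-\phi(s,\mu)\ge a(t-s)+\int q(x'-x)\beta(d(x,x',q))-\sigma\big((t-s)^2+\|\mathrm{p}^{1,2}\sharp\beta\|^2\big)-\varepsilon\big(|t-s|^2+W_2^2(\nu,\mu)\big)^{1/2}.$$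 $\partial^+_{P,\varepsilon}\phi(s,\mu)$ is the set of $(a,\gamma)$ with $\mathrm{p}^1\sharp\gamma=\mu$ for which there are such $\alpha,\sigma$ with, for all the same $(t,\nu),\beta$, $$\phi(t,\nu)-\phi(s,\mu)\le a(t-s)+\int q(x'-x)\beta(d(x,x',q))+\sigma\big((t-s)^2+\|\mathrm{p}^{1,2}\sharp\beta\|^2\big)+\varepsilon\big(|t-s|^2+W_2^2(\nu,\mu)\big)^{1/2}.$$ **Barycenter.** $\mathrm{b}[\gamma](x):=\int_{\mathbb{R}^{d*}}q\,\gamma(dq|x)$, with $\gamma(\cdot|x)$ the disintegration of $\gamma$ w.r.t. $\mathrm{p}^1\sharp\gamma$. *)

(* Defs.v *)
From HB Require Import structures.
From mathcomp Require Import all_boot all_order all_algebra.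
From mathcomp Require Import all_classical all_reals all_analysis.
From mathcomp Require Import measurable_realfun giry.
From mathcomp Require Import ring lra.
Set Implicit Arguments.
Unset Strict Implicit.
Unset Printing Implicit Defensive.
Import Order.TTheory GRing.Theory Num.Theory.
Import numFieldNormedType.Exports.
Local Open Scope classical_set_scope.
Local Open Scope ring_scope.

(* Vectors of R^d are column vectors 'cV[R]_d, elements of R^{d*} are row
   vectors 'rV[R]_d, and the pairing q(v) is the entry of q *m v.
   Matrices carry their Borel sigma-algebra.  On products we use the library's
   product sigma-algebra, which is the Borel one by second countability. *)
Section borel_matrix.
Context {R : realType} {m n : nat}.

Let mx_measurableC (A : set 'M[R]_(m, n)) :
  <<s @open 'M[R]_(m, n) >> A -> <<s @open 'M[R]_(m, n) >> (~` A).
Proof. exact: sigma_algebraC. Qed.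

HB.instance Definition _ :=
  @isMeasurable.Build (sigma_display (@open 'M[R]_(m, n))) 'M[R]_(m, n)
    <<s @open 'M[R]_(m, n) >> (@sigma_algebra0 _ setT _) mx_measurableC
    (@sigma_algebra_bigcup _ setT _).

End borel_matrix.

Section borel_matrix_theory.
Context {R : realType} {m n : nat}.
Local Notation M := 'M[R]_(m, n).

Lemma measurable_coord (i : 'I_m) (j : 'I_n) :
  measurable_fun [set: M] (fun A : M => A i j).
Proof.
apply: (measurability _ (RGenOInfty.measurableE R)) => _ [_ [x ->] <-].
rewrite setTI; apply: sub_sigma_algebra.
apply: (@open_comp M R (fun A : M => A i j)) => //.
by move=> A _; exact: coord_continuous.
Qed.

Lemma measurable_mxP d (T : measurableType d) (f : T -> M) :
  (forall i j, measurable_fun setT (fun x => f x i j)) ->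
  measurable_fun setT f.
Proof.
move=> mf; apply: (measurability _ (erefl (<<s @open M >>))) => _ [U oU <-].
rewrite setTI.
pose r k : R := k.+1%:R^-1.
pose c (a : 'M[rat]_(m, n)) : M := map_mx ratr a.
pose Idx := ('M[rat]_(m, n) * nat)%type.
pose F (p : Idx) : set T := if `[< ball (c p.1) (r p.2) `<=` U >]
  then f @^-1` (ball (c p.1) (r p.2)) else set0.
have -> : f @^-1` U = \bigcup_p F p.
  apply/seteqP; split=> [x /= Ufx|x [p _]]; last first.
    by rewrite /F; case: asboolP => // sU; apply: sU.
  have /nbhs_ballP[e /= e0 sU] := open_nbhs_nbhs (conj oU Ufx).
  have [k rk] : exists k, r k < e / 2.
    have e20 : 0 < e / 2 by rewrite divr_gt0.
    have [k _ ke] := near_infty_natSinv_lt (PosNum e20).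
    by exists k; exact: (ke k (leqnn k)).
  have r0 : 0 < r k by rewrite invr_gt0.
  have [a ax] : exists a : 'M[rat]_(m, n),
      forall i j, `|ratr (a i j) - f x i j| < r k.
    have /all_sig[a ax] : forall ij : 'I_m * 'I_n,
        {q : rat | `|ratr q - f x ij.1 ij.2| < r k}.
      move=> [i j]; apply: cid => /=.
      have [q] : exists q : rat, ratr q \in `]f x i j - r k, f x i j + r k[.
        by apply: rat_in_itvoo; lra.
      rewrite in_itv/= => /andP[q1 q2]; exists q.
      by rewrite ltr_norml; apply/andP; split; lra.
    by exists (\matrix_(i, j) a (i, j)) => i j; rewrite mxE; exact: ax.
  have sball : ball (c a) (r k) `<=` U.
    move=> y [_ cy]; apply: sU; split=> // i j; rewrite /ball /=.
    have := cy i j; rewrite /ball /= /c mxE => cyij.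
    have axij := ax i j.
    rewrite (_ : f x i j - y i j =
      (ratr (a i j) - y i j) - (ratr (a i j) - f x i j)); last by ring.
    rewrite (le_lt_trans (ler_normB _ _))//.
    by rewrite (splitr e) ltrD// (lt_trans _ rk).
  exists (a, k) => //; rewrite /F /= asboolT//.
  by split=> // i j; rewrite /c mxE; exact: ax.
apply: countable_bigcupT_measurable => [|[a k]]; first exact: countableP.
rewrite /F /=; case: ifPn => // _.
rewrite (_ : f @^-1` _ = \bigcap_(i in [set: 'I_m]) \bigcap_(j in [set: 'I_n])
    ((fun x => f x i j) @^-1` ball (c a i j) (r k))); last first.
  apply/seteqP; split=> [x /= [_ h] i _ j _|x h]; first exact: h.
  split=> [|i j]; first by rewrite invr_gt0.
  exact: (h i I j I).
apply: fin_bigcap_measurable => // i _; apply: fin_bigcap_measurable => // j _.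
rewrite -[X in measurable X]setTI; apply: mf => //.
exact: open_measurable (ball_open _ _).
Qed.

End borel_matrix_theory.

(* Squared Euclidean norm. The library's norm on matrices is the sup norm. *)
Definition sqn {R : realType} {m n : nat} (A : 'M[R]_(m, n)) : R :=
  \sum_i \sum_j A i j ^+ 2.

Lemma sqn_ge0 {R : realType} {m n : nat} (A : 'M[R]_(m, n)) : 0 <= sqn A.
Proof. by rewrite sumr_ge0// => i _; rewrite sumr_ge0// => j _; rewrite sqr_ge0. Qed.

Lemma measurable_sqn {R : realType} {m n : nat} :
  measurable_fun [set: 'M[R]_(m, n)] sqn.
Proof.
apply: measurable_sum => i; apply: measurable_sum => j.
by apply: measurable_funX; exact: measurable_coord.
Qed.

Lemma sqnDZ {R : realType} {m n : nat} (h : R) (A B : 'M[R]_(m, n)) :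
  sqn (A + h *: B) <= 2 * sqn A + 2 * h ^+ 2 * sqn B.
Proof.
rewrite /sqn !mulr_sumr -big_split ler_sum// => i _.
rewrite !mulr_sumr -big_split ler_sum// => j _.
by rewrite !mxE /=; have := sqr_ge0 (A i j - h * B i j); nra.
Qed.

Section projections.
Context {d1 d2 d3} {T1 : measurableType d1} {T2 : measurableType d2}
  {T3 : measurableType d3}.

Definition pr12 (z : T1 * T2 * T3) : T1 * T2 := z.1.
Definition pr13 (z : T1 * T2 * T3) : T1 * T3 := (z.1.1, z.2).
Definition pr2 (z : T1 * T2 * T3) : T2 := z.1.2.

Let measurable_pr13 : measurable_fun [set: T1 * T2 * T3] pr13.
Proof.
apply: measurable_fun_pair => //; exact: (measurableT_comp measurable_fst).
Qed.

Let measurable_pr2 : measurable_fun [set: T1 * T2 * T3] pr2.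
Proof. exact: (measurableT_comp measurable_snd). Qed.

HB.instance Definition _ := isMeasurableFun.Build _ _ _ _ (@fst T1 T2)
  measurable_fst.
HB.instance Definition _ := isMeasurableFun.Build _ _ _ _ (@snd T1 T2)
  measurable_snd.
HB.instance Definition _ := isMeasurableFun.Build _ _ _ _ pr12 measurable_fst.
HB.instance Definition _ := isMeasurableFun.Build _ _ _ _ pr13 measurable_pr13.
HB.instance Definition _ := isMeasurableFun.Build _ _ _ _ pr2 measurable_pr2.

End projections.

(* Probability measures with finite second moment, for the squared norm N.
   A library measure is a function on all sets, unconstrained outside the
   sigma-algebra, so equality of measures is the library's relation measure_eq,
   i.e. equality on measurable sets.  Functions on P2 are not required to
   respect it: those that do are the functions of measures in the usual sense. *)
Record P2 {disp : measure_display} {T : measurableType disp} {R : realType}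
    (N : T -> R) := MkP2 {
  P2_probability :> probability T R ;
  P2_moment : (\int[P2_probability]_x (N x)%:E < +oo)%E }.

Definition P2vec (R : realType) (d : nat) := P2 (@sqn R d 1).
Definition P2covec (R : realType) (d : nat) :=
  P2 (fun z : 'cV[R]_d * 'rV[R]_d => sqn z.1 + sqn z.2).
Definition P2triple (R : realType) (d : nat) :=
  P2 (fun z : 'cV[R]_d * 'cV[R]_d * 'rV[R]_d =>
    sqn z.1.1 + sqn z.1.2 + sqn z.2).

Section wasserstein.
Context {R : realType} {d : nat}.
Local Notation X := 'cV[R]_d.

Definition couplings (mu nu : P2vec R d) : set (probability (X * X)%type R) :=
  [set pi | measure_eq (distribution pi fst) mu /\
            measure_eq (distribution pi snd) nu].

Definition W2 (mu nu : P2vec R d) : R :=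
  Num.sqrt (fine (ereal_inf
    [set (\int[pi]_z (sqn (z.1 - z.2))%:E)%E | pi in couplings mu nu])).

Definition plan_norm (pi : probability (X * X)%type R) : R :=
  Num.sqrt (\int[pi]_z sqn (z.1 - z.2)).

Definition dist (t : R) (nu : P2vec R d) (s : R) (mu : P2vec R d) : R :=
  Num.sqrt (`|t - s| ^+ 2 + W2 nu mu ^+ 2).

End wasserstein.

Section L2.
Context {R : realType} {d : nat}.
Local Notation X := 'cV[R]_d.

Definition sq_integrable {m n : nat} (mu : P2vec R d) (f : X -> 'M[R]_(m, n)) :=
  measurable_fun setT f /\ (\int[mu]_x (sqn (f x))%:E < +oo)%E.

Definition L2norm {m n : nat} (mu : P2vec R d) (f : X -> 'M[R]_(m, n)) : R :=
  Num.sqrt (\int[mu]_x sqn (f x)).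

Definition pairing (mu : P2vec R d) (p : X -> 'rV[R]_d) (v : X -> X) : R :=
  \int[mu]_x (p x *m v x) 0 0.

(* Square-integrable vector fields, not identified up to mu-a.e. equality:
   everything below depends only on a.e. classes. *)
Record L2 (mu : P2vec R d) := MkL2 {
  L2_fun :> X -> X ;
  L2_sq_integrable : sq_integrable mu L2_fun }.

HB.instance Definition _ (mu : P2vec R d) := gen_eqMixin (L2 mu).
HB.instance Definition _ (mu : P2vec R d) := gen_choiceMixin (L2 mu).
HB.instance Definition _ (mu : P2vec R d) := hasNbhs.Build (L2 mu)
  (fun v => filter_from [set e : R | 0 < e]
    (fun e => [set w : L2 mu | L2norm mu (fun x => w x - v x) < e])).

Definition tangent_norm (mu : P2vec R d) (theta : R) (v : L2 mu) : R :=
  Num.sqrt (theta ^+ 2 + L2norm mu v ^+ 2).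

Section idD.
Context (mu : P2vec R d) (h : R) (v : L2 mu).

Definition idD (x : X) : X := x + h *: v x.

Lemma measurable_idD : measurable_fun setT idD.
Proof.
apply: measurable_mxP => i j.
rewrite (_ : (fun x => idD x i j) = (fun x => x i j + h * v x i j)); last first.
  by apply/funext => x; rewrite !mxE.
apply: measurable_funD; first exact: measurable_coord.
apply: measurable_funM => //.
apply: (measurableT_comp (measurable_coord i j)).
exact: (L2_sq_integrable v).1.
Qed.

HB.instance Definition _ := isMeasurableFun.Build _ _ _ _ idD measurable_idD.

Let idD_moment : (\int[distribution mu idD]_x (sqn x)%:E < +oo)%E.
Proof.
have msv := measurableT_comp measurable_sqn (L2_sq_integrable v).1.
rewrite ge0_integral_distribution//=; last 2 first.
  by apply/measurable_EFinP; exact: measurable_sqn.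
  by move=> x; rewrite lee_fin sqn_ge0.
apply: (@le_lt_trans _ _ (\int[mu]_x (2%:E * (sqn x)%:E
    + (2 * h ^+ 2)%:E * (sqn (v x))%:E))%E).
  apply: ge0_le_integral => //=.
  - by move=> x _; rewrite lee_fin sqn_ge0.
  - apply/measurable_EFinP; apply: (measurableT_comp measurable_sqn).
    exact: measurable_idD.
  - apply/measurable_EFinP; apply: measurable_funD; apply: measurable_funM => //.
    exact: measurable_sqn.
  - by move=> x _; rewrite -!EFinM -EFinD lee_fin sqnDZ.
rewrite ge0_integralD//=; last 4 first.
- by move=> x _; rewrite -EFinM lee_fin mulr_ge0// sqn_ge0.
- apply/measurable_EFinP; apply: measurable_funM => //; exact: measurable_sqn.
- by move=> x _; rewrite -EFinM lee_fin mulr_ge0 ?sqn_ge0//;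
  exact: mulr_ge0 (ler0n _ 2) (sqr_ge0 _).
- by apply/measurable_EFinP; apply: measurable_funM.
rewrite !ge0_integralZl//=; first last.
- by move=> x _; rewrite lee_fin sqn_ge0.
- by apply/measurable_EFinP; exact: measurable_sqn.
- by rewrite lee_fin; exact: mulr_ge0 (ler0n _ 2) (sqr_ge0 _).
- by move=> x _; rewrite lee_fin sqn_ge0.
- by apply/measurable_EFinP.
have fin (f : X -> R) : (forall x, 0 <= f x) ->
    (\int[mu]_x (f x)%:E < +oo -> \int[mu]_x (f x)%:E \is a fin_num)%E.
  by move=> f0 foo; rewrite ge0_fin_numE// integral_ge0// => x _; rewrite lee_fin.
have fx := fin (@sqn _ _ _) (@sqn_ge0 _ _ _) (P2_moment mu).
have fv := fin (sqn \o v) (fun x => sqn_ge0 (v x)) (L2_sq_integrable v).2.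
by apply: lte_add_pinfty; rewrite ltey_eq fin_numM.
Qed.

(* (Id + h v) # mu *)
Definition push_idD : P2vec R d := MkP2 idD_moment.

End idD.
End L2.

Section barycenter.
Context {R : realType} {d : nat}.

(* k is a version of the disintegration of gamma with respect to its first
   marginal: gamma(d(x, q)) = k x (dq) (p^1 # gamma)(dx).  Versions agree for
   almost every x; the barycenter is taken with respect to a given one. *)
Definition disintegration (gamma : P2covec R d) (k : R.-pker 'cV[R]_d ~> 'rV[R]_d) :=
  forall C : set ('cV[R]_d * 'rV[R]_d), measurable C ->
    (gamma C = \int[distribution gamma fst]_x k x (xsection C x))%E.

Definition barycenter (k : R.-pker 'cV[R]_d ~> 'rV[R]_d) (x : 'cV[R]_d) : 'rV[R]_d :=
  \row_j \int[k x]_q q 0 j.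

End barycenter.

Section differentials.
Context {R : realType} {d : nat}.
Implicit Types (phi : R -> P2vec R d -> \bar R) (s r eps a : R)
  (mu : P2vec R d).

(* Functions on ]s - r, s + r[ x B_r(mu) are represented by total functions phi.
   Their values outside this set are irrelevant: the proximal differentials are
   restricted to it, and in the directional ones the lower and upper limits
   only see points converging to (s, mu). *)
Definition domain s mu r (t : R) (nu : P2vec R d) :=
  s - r < t < s + r /\ W2 nu mu <= r.

Definition diff_quotient phi s mu a (p : 'cV[R]_d -> 'rV[R]_d)
    (z : R * (R * L2 mu)) : \bar R :=
  let: (h, (theta, v)) := z in
  (h^-1%:E * (phi (s + h * theta)%R (push_idD h v) - phi s mu
              - (h * (a * theta + pairing mu p v))%:E))%E.

Definition subdiffD phi s mu eps : set (R * ('cV[R]_d -> 'rV[R]_d)) :=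
  [set ap : R * ('cV[R]_d -> 'rV[R]_d) | sq_integrable mu ap.2 /\
    forall (theta : R) (v : L2 mu),
      ((- (eps * tangent_norm theta v))%:E <=
       limf_einf (diff_quotient phi s ap.1 ap.2)
         (filter_prod (0 : R)%R^'+ (nbhs (theta, v))))%E].

Definition superdiffD phi s mu eps : set (R * ('cV[R]_d -> 'rV[R]_d)) :=
  [set ap : R * ('cV[R]_d -> 'rV[R]_d) | sq_integrable mu ap.2 /\
    forall (theta : R) (v : L2 mu),
      (limf_esup (diff_quotient phi s ap.1 ap.2)
         (filter_prod (0 : R)%R^'+ (nbhs (theta, v))) <=
       (eps * tangent_norm theta v)%:E)%E].

Definition prox_linear s a (t : R) (beta : P2triple R d) : R :=
  a * (t - s) + \int[beta]_z (z.2 *m (z.1.2 - z.1.1)) 0 0.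

Definition prox_error s mu eps sigma (t : R) (nu : P2vec R d)
    (beta : P2triple R d) : R :=
  sigma * ((t - s) ^+ 2 + plan_norm (distribution beta pr12) ^+ 2)
  + eps * dist t nu s mu.

Definition subdiffP phi s mu r eps : set (R * P2covec R d) :=
  [set ag : R * P2covec R d | measure_eq (distribution ag.2 fst) mu /\
    exists alpha sigma : R, [/\ 0 < alpha <= r, 0 <= sigma &
      forall t nu, dist t nu s mu <= alpha -> domain s mu r t nu ->
      forall beta : P2triple R d,
        measure_eq (distribution beta pr13) ag.2 ->
        measure_eq (distribution beta pr2) nu ->
        ((prox_linear s ag.1 t beta - prox_error s mu eps sigma t nu beta)%:E
         <= phi t nu - phi s mu)%E]].

Definition superdiffP phi s mu r eps : set (R * P2covec R d) :=
  [set ag : R * P2covec R d | measure_eq (distribution ag.2 fst) mu /\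
    exists alpha sigma : R, [/\ 0 < alpha <= r, 0 <= sigma &
      forall t nu, dist t nu s mu <= alpha -> domain s mu r t nu ->
      forall beta : P2triple R d,
        measure_eq (distribution beta pr13) ag.2 ->
        measure_eq (distribution beta pr2) nu ->
        (phi t nu - phi s mu <=
         (prox_linear s ag.1 t beta + prox_error s mu eps sigma t nu beta)%:E)%E]].

End differentials.

(* Main.v *)
Require Import Defs.
From HB Require Import structures.
From mathcomp Require Import all_boot all_order all_algebra.
From mathcomp Require Import all_classical all_reals all_analysis.
From mathcomp Require Import measurable_realfun giry ring lra.
Import Order.TTheory GRing.Theory Num.Theory.
Import numFieldNormedType.Exports.
Local Open Scope classical_set_scope.
Local Open Scope ring_scope.

(* Given a direction (theta, v) and h > 0, the proximal inequality is applied at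
   t = s + h theta and nu = (Id + h v)#mu, with beta the image of gamma under
   (x, q) |-> (x, x + h v(x), q).  Disintegrating gamma turns the linear term
   into h (a theta + <b[gamma], v>), while the quadratic term is
   sigma h^2 |(theta, v)|^2 and, since (Id + h v, Id)#mu is a coupling of nu and
   mu, the distance term is at most eps h |(theta, v)|.  After division by h,
   only eps |(theta, v)| survives in the limit. *)

(** * Integration against a disintegrated measure *)

Section integral_disintegration.
Context {dX dY} {X : measurableType dX} {Y : measurableType dY} {R : realType}.
Context (P : probability (X * Y)%type R) (m : probability X R)
  (k : R.-pker X ~> Y).

(** The product of the Dirac mass at [x] with [k x], carried by the fibre over [x]. In this form the
    disintegration identity says that [P] is the Giry bind of [m] along [graph]. *)
Let graph (x : X) := pushforward (k x) (pair x).

Let graph0 x : graph x set0 = 0%E.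
Proof. by rewrite /graph /pushforward preimage_set0 measure0. Qed.

Let graph_ge0 x A : (0 <= graph x A)%E.
Proof. exact: measure_ge0. Qed.

Let graph_sigma_additive x : semi_sigma_additive (graph x).
Proof. exact: measure_semi_sigma_additive. Qed.

HB.instance Definition _ x := isMeasure.Build _ _ _ (graph x)
  (graph0 x) (graph_ge0 x) (graph_sigma_additive x).

Let graph_setT x : (graph x [set: X * Y] <= 1)%E.
Proof. by rewrite /graph /pushforward preimage_setT prob_kernel. Qed.

HB.instance Definition _ x :=
  Measure_isSubProbability.Build _ _ _ (graph x) (graph_setT x).

Let graphE x A : graph x A = k x (xsection A x).
Proof. by rewrite xsectionE. Qed.

Let measurable_graph :
  measurable_fun [set: X] (graph : X -> giry (X * Y)%type R).
Proof.
apply: measurable_giry_codensity => // B mB.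
rewrite (_ : (fun x => _) = fun x => k x (xsection B x)); last first.
  by apply/funext => x; exact: graphE.
by apply: measurable_fun_xsection_finite_kernel; rewrite inE.
Qed.

(** [P] agrees on measurable sets with the bind of [m] along [graph], and an integral against a bind
    is an iterated integral; the inner one is then pulled back along [pair x]. *)
Lemma ge0_integral_disintegration (f : X * Y -> \bar R) :
  (forall C, measurable C -> P C = \int[m]_x k x (xsection C x))%E ->
  measurable_fun setT f -> (forall z, 0 <= f z)%E ->
  (\int[P]_z f z = \int[m]_x \int[k x]_y f (x, y))%E.
Proof.
move=> PE mf f0.
transitivity (giry_int (giry_bind (m : giry X R) measurable_graph) f).
  apply: eq_measure_integral => C mC _.
  apply: (etrans (PE _ mC)).
  rewrite /giry_bind /= /giry_join/= /giry_int ge0_integral_pushforward//.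
    by apply: eq_integral => x _ /=; rewrite /giry_ev graphE.
  exact: measurable_giry_ev.
rewrite giry_int_bind//; apply: eq_integral => x _.
by rewrite /giry_int ge0_integral_pushforward.
Qed.

(** Apply the nonnegative case to the positive and negative parts. Integrability of [f] makes both
    outer integrals finite, so their difference can be taken under the integral over [m]. *)
Lemma integral_disintegration (f : X * Y -> \bar R) :
  (forall C, measurable C -> P C = \int[m]_x k x (xsection C x))%E ->
  P.-integrable setT f ->
  (\int[P]_z f z = \int[m]_x \int[k x]_y f (x, y))%E.
Proof.
move=> PE intf.
have /integrableP[mf _] := intf.
have fin g : measurable_fun setT g -> (forall z, 0 <= g z)%E ->
    (\int[P]_z g z < +oo)%E ->
    m.-integrable setT (fun x => \int[k x]_y g (x, y))%E.
  move=> mg g0 goo; apply/integrableP; split.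
    exact: measurable_fun_integral_finite_kernel.
  rewrite (eq_integral (fun x => \int[k x]_y g (x, y))%E).
    by rewrite -ge0_integral_disintegration.
  by move=> x _; rewrite gee0_abs// integral_ge0.
have mfp : measurable_fun setT f^\+%E by apply/measurable_funepos.
have mfn : measurable_fun setT f^\-%E by apply/measurable_funeneg.
rewrite integralE !ge0_integral_disintegration// -integralB//; last 2 first.
- by apply: fin => //; exact: integral_funepos_lt_pinfty.
- by apply: fin => //; exact: integral_funeneg_lt_pinfty.
apply: eq_integral => x _; rewrite [RHS]integralE.
by congr (_ - _)%E; apply: eq_integral => y _; rewrite ?funeposE ?funenegE.
Qed.

End integral_disintegration.

(** The integral is by definition the difference in [\bar R] of the integrals of the two parts,
    finite or not, so the nonnegative case suffices. *)
Lemma measurable_integral_kernel {d1 d2} {X : measurableType d1}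
    {Y : measurableType d2} {R : realType} (k : R.-fker X ~> Y)
    (f : X * Y -> \bar R) :
  measurable_fun setT f ->
  measurable_fun setT (fun x => \int[k x]_y f (x, y))%E.
Proof.
move=> mf.
have mfp : measurable_fun setT f^\+%E by apply/measurable_funepos.
have mfn : measurable_fun setT f^\-%E by apply/measurable_funeneg.
rewrite (_ : (fun x => _) =
    (fun x => \int[k x]_y f^\+ (x, y) - \int[k x]_y f^\- (x, y))%E); last first.
  apply/funext => x; rewrite integralE.
  by congr (_ - _)%E; apply: eq_integral => y _; rewrite ?funeposE ?funenegE.
by apply: emeasurable_funB; exact: measurable_fun_integral_finite_kernel.
Qed.

Lemma integral_measure_eq {d} {T : measurableType d} {R : realType}
    (m1 m2 : {measure set T -> \bar R}) (f : T -> \bar R) :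
  measure_eq m1 m2 -> (\int[m1]_x f x = \int[m2]_x f x)%E.
Proof. by move=> m12; apply: eq_measure_integral => A mA _; exact: m12. Qed.

(** * Square integrability under a probability, and the pairing of rows with columns *)

Section square_integrable.
Context {d} {T : measurableType d} {R : realType} (P : probability T R).

Lemma le_EFin_integrable {f g : T -> R} :
  measurable_fun setT f -> measurable_fun setT g ->
  (forall x, `|f x| <= g x) -> (\int[P]_x (g x)%:E < +oo)%E ->
  P.-integrable setT (EFin \o f).
Proof.
move=> mf mg fg goo; apply/integrableP; split; first exact/measurable_EFinP.
apply: le_lt_trans goo; apply: ge0_le_integral => //.
- by apply: measurableT_comp => //; exact/measurable_EFinP.
- exact/measurable_EFinP.
- by move=> x _; rewrite /= lee_fin.
Qed.

Lemma sqr_integrable {f : T -> R} :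
  measurable_fun setT f -> (\int[P]_x (f x ^+ 2)%:E < +oo)%E ->
  P.-integrable setT (EFin \o f).
Proof.
move=> mf foo; have mf2 := measurable_funX 2 mf.
(* Constants are integrable under a probability, and [|y| <= 1 + y^2]. *)
apply: (@le_EFin_integrable _ (fun x => 1 + f x ^+ 2)) => //.
- exact: measurable_funD.
- move=> x; rewrite -real_normK ?num_real//.
  by have := sqr_ge0 (`|f x| - 1); nra.
- rewrite (eq_integral (fun x => 1%:E + (f x ^+ 2)%:E)%E)//.
  rewrite ge0_integralD//.
  + by rewrite integral_cst//= probability_setT mule1 lte_add_pinfty// ltry.
  + by move=> x _; rewrite lee_fin sqr_ge0.
  + exact/measurable_EFinP.
Qed.

(* Integrate [2 m y - m^2 <= y^2], with [m] the mean. *)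
Lemma sqr_Rintegral_le {f : T -> R} : measurable_fun setT f ->
  (((\int[P]_x f x) ^+ 2)%:E <= \int[P]_x (f x ^+ 2)%:E)%E.
Proof.
move=> mf; have mf2 := measurable_funX 2 mf.
have [foo|] := ltP (\int[P]_x (f x ^+ 2)%:E)%E +oo%E; last first.
  by rewrite leye_eq => /eqP->; rewrite leey.
have intf := sqr_integrable mf foo.
set m := \int[P]_x f x.
have intg : P.-integrable setT (EFin \o (fun x => 2 * m * f x - m ^+ 2)).
  rewrite (_ : EFin \o _ =
    (fun x => (2 * m)%:E * (f x)%:E - (m ^+ 2)%:E)%E)//.
  apply: integrableB => //; first exact: integrableZl.
  exact: finite_measure_integrable_cst.
have intf2 : P.-integrable setT (EFin \o (fun x => f x ^+ 2)).
  apply: (@le_EFin_integrable _ (fun x => f x ^+ 2)) => // x.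
  by rewrite ger0_norm// sqr_ge0.
rewrite (@le_trans _ _ (\int[P]_x (2 * m * f x - m ^+ 2)%:E)%E)//; last first.
  apply: le_integral => // x _; rewrite lee_fin.
  by have := sqr_ge0 (f x - m); nra.
rewrite (eq_integral (fun x => (2 * m)%:E * (f x)%:E - (m ^+ 2)%:E)%E)//.
rewrite integralB//; last 2 first.
- exact: integrableZl.
- exact: finite_measure_integrable_cst.
rewrite integralZl// integral_cst//= probability_setT mule1.
rewrite -[(\int[P]_x (f x)%:E)%E]fineK; last exact: integrable_fin_num.
by rewrite -EFinM -EFinB lee_fin -/(Rintegral P setT f) -/m; lra.
Qed.

End square_integrable.

Lemma sqn_row {R : realType} {d} (q : 'rV[R]_d) : sqn q = \sum_j q 0 j ^+ 2.
Proof. by rewrite /sqn big_ord1. Qed.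

Lemma sqn_col {R : realType} {d} (w : 'cV[R]_d) : sqn w = \sum_j w j 0 ^+ 2.
Proof. by rewrite /sqn; under eq_bigr do rewrite big_ord1. Qed.

(** Young's inequality in each coordinate: crude, but it gives the integrability of the pairing. *)
Lemma normr_mulmx_le {R : realType} {d} (q : 'rV[R]_d) (w : 'cV[R]_d) :
  `|(q *m w) 0 0| <= sqn q + sqn w.
Proof.
rewrite mxE sqn_row sqn_col -big_split (le_trans (ler_norm_sum _ _ _))//=.
apply: ler_sum => j _; rewrite normrM -(real_normK (num_real (q 0 j))).
rewrite -(real_normK (num_real (w j 0))).
by have := sqr_ge0 (`|q 0 j| - `|w j 0|); have := normr_ge0 (q 0 j);
  have := normr_ge0 (w j 0); nra.
Qed.

Lemma measurable_mulmx00 {disp} {T : measurableType disp} {R : realType} {d}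
    (f : T -> 'rV[R]_d) (g : T -> 'cV[R]_d) :
  measurable_fun setT f -> measurable_fun setT g ->
  measurable_fun setT (fun x => (f x *m g x) 0 0).
Proof.
move=> mf mg; under eq_fun do rewrite mxE.
apply: measurable_sum => j; apply: measurable_funM.
  exact: (measurableT_comp (measurable_coord 0 j)).
exact: (measurableT_comp (measurable_coord j 0)).
Qed.

(** * The barycenter and its pairing with vector fields *)

Section kernel_probability.
Context {d1 d2} {X : measurableType d1} {Y : measurableType d2} {R : realType}
  (k : R.-pker X ~> Y).

(* The library makes [k x] canonically a measure only. *)
Definition kernel_at (x : X) : set Y -> \bar R := k x.

HB.instance Definition _ x := Measure.copy (kernel_at x) (k x).
HB.instance Definition _ x :=
  Measure_isProbability.Build _ _ _ (kernel_at x) (prob_kernel x).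

End kernel_probability.

Section barycenter.
Context {R : realType} {d : nat} {mu : P2vec R d} {gamma : P2covec R d}
  {k : R.-pker 'cV[R]_d ~> 'rV[R]_d}.

Lemma P2covec_moment_snd : (\int[gamma]_z (sqn z.2)%:E < +oo)%E.
Proof.
apply: le_lt_trans (P2_moment gamma); apply: ge0_le_integral => //=.
- by move=> z _; rewrite lee_fin sqn_ge0.
- by apply/measurable_EFinP; exact: (measurableT_comp measurable_sqn).
- apply/measurable_EFinP; apply: measurable_funD;
    exact: (measurableT_comp measurable_sqn).
- by move=> z _; rewrite lee_fin lerDr sqn_ge0.
Qed.

Lemma measurable_barycenter : measurable_fun setT (barycenter k).
Proof.
apply: measurable_mxP => i j; under eq_fun do rewrite mxE.
apply: (measurableT_comp (fine_measurable measurableT)).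
apply: (measurable_integral_kernel k (fun z => (z.2 0 j)%:E)).
by apply/measurable_EFinP; exact: (measurableT_comp (measurable_coord 0 j)).
Qed.

(** Jensen's inequality in each coordinate. It holds at every [x]: a fibre of infinite second moment
    makes the right-hand side [+oo]. *)
Lemma sqn_barycenter_le (x : 'cV[R]_d) :
  ((sqn (barycenter k x))%:E <= \int[k x]_q (sqn q)%:E)%E.
Proof.
under eq_integral do rewrite sqn_row -sumEFin.
rewrite ge0_integral_sum//; last 2 first.
- by move=> j; apply/measurable_EFinP/measurable_funX; exact: measurable_coord.
- by move=> j q _; rewrite lee_fin sqr_ge0.
rewrite sqn_row -sumEFin; apply: lee_sum => j _.
rewrite mxE; apply: (sqr_Rintegral_le (kernel_at k x)).
exact: measurable_coord.
Qed.

Lemma ge0_integral_fst (f : 'cV[R]_d -> \bar R) :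
  measure_eq (distribution gamma fst) mu ->
  measurable_fun setT f -> (forall x, 0 <= f x)%E ->
  (\int[gamma]_z f z.1 = \int[mu]_x f x)%E.
Proof.
move=> gmu mf f0; rewrite -(integral_measure_eq _ _ f gmu).
by rewrite ge0_integral_distribution.
Qed.

(** Jensen's bound is integrated against [mu]: by disintegration, the fibre second moments add up to
    the second moment of [gamma] in [q]. *)
Lemma sq_integrable_barycenter :
  measure_eq (distribution gamma fst) mu -> disintegration gamma k ->
  sq_integrable mu (barycenter k).
Proof.
move=> gmu hk; split; first exact: measurable_barycenter.
apply: le_lt_trans P2covec_moment_snd.
rewrite (ge0_integral_disintegration _ _ k _ hk)//; last 2 first.
- by apply/measurable_EFinP; exact: (measurableT_comp measurable_sqn).
- by move=> z; rewrite lee_fin sqn_ge0.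
rewrite (integral_measure_eq _ _ _ gmu); apply: ge0_le_integral => //.
- by move=> x _; rewrite lee_fin sqn_ge0.
- apply/measurable_EFinP; apply: (measurableT_comp measurable_sqn).
  exact: measurable_barycenter.
- apply: (measurable_integral_kernel k (fun z => (sqn z.2)%:E)).
  by apply/measurable_EFinP; exact: (measurableT_comp measurable_sqn).
- by move=> x _; exact: sqn_barycenter_le.
Qed.

(** The pairing is dominated by [sqn q + sqn (v x)]; the first term is controlled by the moment of
    [gamma], the second because the first marginal of [gamma] is [mu]. *)
Lemma integrable_covec_pairing (v : L2 mu) :
  measure_eq (distribution gamma fst) mu ->
  gamma.-integrable setT (fun z => ((z.2 *m v z.1) 0 0)%:E).
Proof.
move=> gmu; have [mv voo] := L2_sq_integrable v.
have msv := measurableT_comp measurable_sqn mv.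
have ms1 : measurable_fun [set: 'cV[R]_d * 'rV[R]_d] (fun z => sqn z.2).
  exact: (measurableT_comp measurable_sqn).
have ms2 : measurable_fun [set: 'cV[R]_d * 'rV[R]_d] (fun z => sqn (v z.1)).
  exact: (measurableT_comp msv).
apply: (le_EFin_integrable _ (g := fun z => sqn z.2 + sqn (v z.1))).
- apply: measurable_mulmx00 => //; exact: (measurableT_comp mv).
- exact: measurable_funD.
- by move=> z; exact: normr_mulmx_le.
- rewrite (eq_integral (fun z => (sqn z.2)%:E + (sqn (v z.1))%:E)%E)//.
  rewrite ge0_integralD//; last 4 first.
  + by move=> z _; rewrite lee_fin sqn_ge0.
  + exact/measurable_EFinP.
  + by move=> z _; rewrite lee_fin sqn_ge0.
  + exact/measurable_EFinP.
  rewrite lte_add_pinfty// ?P2covec_moment_snd//.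
  rewrite (ge0_integral_fst (fun x => (sqn (v x))%:E))//.
    exact/measurable_EFinP.
  by move=> x; rewrite lee_fin sqn_ge0.
Qed.

(** Integrate first over the fibre, where [v x] is constant: by linearity the fibre average of [q]
    comes out, which is the barycenter. *)
Lemma integral_covec_pairing (v : L2 mu) :
  measure_eq (distribution gamma fst) mu -> disintegration gamma k ->
  \int[gamma]_z (z.2 *m v z.1) 0 0 = pairing mu (barycenter k) v.
Proof.
move=> gmu hk; have [mv voo] := L2_sq_integrable v.
have intg := integrable_covec_pairing v gmu.
have mq : measurable_fun [set: 'cV[R]_d * 'rV[R]_d] (fun z => (sqn z.2)%:E).
  by apply/measurable_EFinP; exact: (measurableT_comp measurable_sqn).
have q0 (z : 'cV[R]_d * 'rV[R]_d) : (0 <= (sqn z.2)%:E)%E.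
  by rewrite lee_fin sqn_ge0.
rewrite /pairing /Rintegral; congr fine.
rewrite (integral_disintegration _ _ k _ hk)//.
rewrite (integral_measure_eq _ _ _ gmu).
(* Linearity over the fibre needs each coordinate of [q] to be integrable, which is obtained only
   for almost every [x]. *)
apply: ae_eq_integral => //.
- apply: (measurable_integral_kernel k (fun z => ((z.2 *m v z.1) 0 0)%:E)).
  by case/integrableP : intg.
- apply/measurable_EFinP; apply: measurable_mulmx00 => //.
  exact: measurable_barycenter.
(* The fibre second moment has a finite integral against [mu], namely the moment of [gamma] in [q];
   hence it is finite almost everywhere. *)
have : mu.-integrable setT (fun x => \int[k x]_q (sqn q)%:E)%E.
  apply/integrableP; split.
    exact: (measurable_integral_kernel k (fun z => (sqn z.2)%:E)).
  rewrite (eq_integral (fun x => \int[k x]_q (sqn q)%:E)%E); last first.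
    move=> x _; rewrite gee0_abs// integral_ge0// => q _.
    by rewrite lee_fin sqn_ge0.
  rewrite -(integral_measure_eq _ _ _ gmu).
  rewrite -(ge0_integral_disintegration _ _ k (fun z => (sqn z.2)%:E) hk)//.
  exact: P2covec_moment_snd.
move=> /(integrable_ae measurableT); apply: filterS => x /(_ I) finx _.
have foo : (\int[kernel_at k x]_q (sqn q)%:E < +oo)%E.
  by rewrite ltey_eq finx.
have intj (j : 'I_d) :
    (kernel_at k x).-integrable setT (EFin \o (fun q => q 0 j)).
  apply: sqr_integrable; first exact: measurable_coord.
  apply: le_lt_trans foo; apply: ge0_le_integral => //.
  - by move=> q _; rewrite lee_fin sqr_ge0.
  - by apply/measurable_EFinP/measurable_funX; exact: measurable_coord.
  - by apply/measurable_EFinP; exact: measurable_sqn.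
  - move=> q _; rewrite lee_fin sqn_row (bigD1 j)//= lerDl sumr_ge0// => i _.
    exact: sqr_ge0.
(* [kernel_at k x] is convertible to [k x] and is the form in which [intj] is stated. *)
rewrite -[LHS]/(\int[kernel_at k x]_q ((q *m v x) 0 0)%:E)%E.
under eq_integral do rewrite mxE -sumEFin.
rewrite integral_sum//; last first.
  move=> j; under eq_fun do rewrite EFinM muleC.
  exact: (integrableZl _ _ (intj j)).
rewrite mxE -sumEFin; apply: eq_bigr => j _.
under eq_integral do rewrite EFinM muleC.
rewrite integralZl//; last exact: intj.
rewrite mxE EFinM muleC fineK//; apply: integrable_fin_num => //; exact: intj.
Qed.

End barycenter.

(** * Norms of vector fields and of directions *)

Section L2norm.
Context {R : realType} {d : nat} {mu : P2vec R d}.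

Lemma sqnZ {m n : nat} (h : R) (A : 'M[R]_(m, n)) :
  sqn (h *: A) = h ^+ 2 * sqn A.
Proof.
rewrite /sqn mulr_sumr; apply: eq_bigr => i _.
by rewrite mulr_sumr; apply: eq_bigr => j _; rewrite mxE exprMn.
Qed.

Lemma measurable_sqn_L2 (v : L2 mu) : measurable_fun setT (fun x => sqn (v x)).
Proof. exact: (measurableT_comp measurable_sqn (L2_sq_integrable v).1). Qed.

Lemma integrable_sqn_L2 (v : L2 mu) :
  mu.-integrable setT (EFin \o (fun x => sqn (v x))).
Proof.
have mv := measurable_sqn_L2 v.
apply: (le_EFin_integrable _ mv mv); last exact: (L2_sq_integrable v).2.
by move=> x; rewrite ger0_norm ?sqn_ge0.
Qed.

Lemma L2norm_ge0 (v : L2 mu) : 0 <= L2norm mu v.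
Proof. exact: sqrtr_ge0. Qed.

Lemma L2norm_sqr (v : L2 mu) : L2norm mu v ^+ 2 = \int[mu]_x sqn (v x).
Proof.
rewrite sqr_sqrtr// fine_ge0// integral_ge0// => x _.
by rewrite lee_fin sqn_ge0.
Qed.

Lemma integral_sqn_L2 (v : L2 mu) :
  (\int[mu]_x (sqn (v x))%:E = (L2norm mu v ^+ 2)%:E)%E.
Proof.
rewrite L2norm_sqr /Rintegral fineK//.
by apply: integrable_fin_num => //; exact: (integrable_sqn_L2 v).
Qed.

(** Young's inequality for [A = B + (A - B)]: the two sides differ, in each entry, by a square over
    [c]. The free weight [c] later yields the triangle inequality without Cauchy-Schwarz. *)
Lemma sqn_le_sqnB {m n : nat} (c : R) (A B : 'M[R]_(m, n)) : 0 < c ->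
  sqn A <= (1 + c) * sqn B + (1 + c^-1) * sqn (A - B).
Proof.
move=> c0; rewrite /sqn !mulr_sumr -big_split ler_sum// => i _.
rewrite !mulr_sumr -big_split ler_sum// => j _.
rewrite !mxE /=; set x := A i j; set y := B i j.
rewrite -subr_ge0 (_ : _ - _ = c^-1 * (c * y - (x - y)) ^+ 2).
  by rewrite mulr_ge0 ?sqr_ge0// invr_ge0 ltW.
by field; rewrite gt_eqF.
Qed.

Lemma sq_integrableB (w v : L2 mu) : sq_integrable mu (fun x => w x - v x).
Proof.
have mB : measurable_fun setT (fun x => w x - v x).
  apply: measurable_mxP => i j; under eq_fun do rewrite !mxE.
  have mc (u : L2 mu) : measurable_fun setT (fun x => u x i j).
    exact: (measurableT_comp (measurable_coord i j) (L2_sq_integrable u).1).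
  exact: measurable_funB.
split=> //; have msd := measurableT_comp measurable_sqn mB.
have intd : mu.-integrable setT
    (EFin \o (fun x => 2 * sqn (w x) + 2 * sqn (v x))).
  have iZ u := integrableZl measurableT 2 (integrable_sqn_L2 u).
  exact: (integrableD measurableT (iZ w) (iZ v)).
apply: (le_lt_trans _ (integrable_lty measurableT intd)).
have /integrableP[md _] := intd.
apply: ge0_le_integral => //.
- by move=> x _; rewrite lee_fin sqn_ge0.
- exact/measurable_EFinP.
(* The difference is read as [w + (-1) *: v], so that [sqnDZ] applies. *)
- move=> x _; rewrite lee_fin -scaleN1r (le_trans (sqnDZ _ _ _))//.
  by rewrite sqrrN expr1n mulr1.
Qed.

Lemma L2norm_sqr_le (c : R) (v w : L2 mu) : 0 < c ->
  L2norm mu w ^+ 2 <= (1 + c) * L2norm mu v ^+ 2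
    + (1 + c^-1) * L2norm mu (fun x => w x - v x) ^+ 2.
Proof.
move=> c0; pose u : L2 mu := MkL2 (sq_integrableB w v).
rewrite (L2norm_sqr u) !L2norm_sqr.
have iv := integrable_sqn_L2 v; have iu := integrable_sqn_L2 u.
have iv' := integrableZl measurableT (1 + c) iv.
have iu' := integrableZl measurableT (1 + c^-1) iu.
rewrite -!RintegralZl// -RintegralD//.
apply: le_Rintegral => //.
- exact: integrable_sqn_L2.
- exact: (integrableD measurableT iv' iu').
- by move=> x _; exact: sqn_le_sqnB.
Qed.

(** The triangle inequality for directions. It is stated with a positive bound [K] in place of the
    norm itself, because the weight in Young's inequality divides by it. *)
Lemma tangent_norm_le (theta theta' K e : R) (v v' : L2 mu) :
  0 < K -> 0 < e -> tangent_norm theta v <= K ->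
  (theta' - theta) ^+ 2 + L2norm mu (fun x => v' x - v x) ^+ 2 <= e ^+ 2 ->
  tangent_norm theta' v' <= K + e.
Proof.
move=> K0 e0 vK de.
(* This weight turns the bound into a perfect square: [(1 + e/K) K^2 + (1 + K/e) e^2 = (K +
   e)^2]. *)
have c0 : 0 < e / K by rewrite divr_gt0.
have Lv := L2norm_sqr_le _ v v' c0; rewrite invf_div in Lv.
have Lt : theta' ^+ 2 <= (1 + e / K) * theta ^+ 2
    + (1 + K / e) * (theta' - theta) ^+ 2.
  rewrite -subr_ge0 (_ : _ - _ =
    (K / e) * (e / K * theta - (theta' - theta)) ^+ 2).
    by rewrite mulr_ge0 ?sqr_ge0// divr_ge0// ltW.
  by field; rewrite !gt_eqF.
have : theta ^+ 2 + L2norm mu v ^+ 2 <= K ^+ 2.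
  rewrite -(@sqr_sqrtr _ (theta ^+ 2 + _)) ?addr_ge0 ?sqr_ge0//.
  by rewrite ler_sqr ?nnegrE ?sqrtr_ge0// ltW.
set N := theta ^+ 2 + _ => NK.
rewrite -(ger0_norm (ltW (addr_gt0 K0 e0))) -sqrtr_sqr ler_wsqrtr//.
apply: (@le_trans _ _ ((1 + e / K) * K ^+ 2 + (1 + K / e) * e ^+ 2));
  last first.
  rewrite le_eqVlt; apply/orP; left; apply/eqP; field.
  by rewrite !gt_eqF.
apply: (@le_trans _ _ ((1 + e / K) * N + (1 + K / e) *
  ((theta' - theta) ^+ 2 + L2norm mu (fun x => v' x - v x) ^+ 2))).
  by rewrite /N; lra.
apply: lerD; apply: ler_wpM2l => //; rewrite addr_ge0// divr_ge0// ltW//.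
Qed.

(* Only this upper semicontinuity of the norm is needed, since the error terms
   are nondecreasing in it. *)
Lemma tangent_norm_near (theta K : R) (v : L2 mu) : tangent_norm theta v < K ->
  \forall z \near (theta, v), tangent_norm z.1 z.2 < K.
Proof.
move=> vK.
have N0 : 0 <= tangent_norm theta v by exact: sqrtr_ge0.
(* One [e] keeps the bound [tangent_norm theta v + e] positive even at the zero direction; the other
   pays for the perturbation, whose two components are each kept below [e / 2]. *)
have [e e0 eK] : exists2 e : R, 0 < e & tangent_norm theta v + e + e < K.
  exists ((K - tangent_norm theta v) / 4); last by lra.
  by rewrite divr_gt0// subr_gt0.
exists (ball theta (e / 2),
  [set w : L2 mu | L2norm mu (fun x => w x - v x) < e / 2]).
  split=> /=; first by apply: nbhsx_ballx; rewrite divr_gt0.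
  by exists (e / 2) => //=; rewrite divr_gt0.
move=> [t w] /= [tb wb].
have K'0 : 0 < tangent_norm theta v + e by rewrite ltr_wpDl.
have De : (t - theta) ^+ 2 + L2norm mu (fun x => w x - v x) ^+ 2 <= e ^+ 2.
  have w0 := L2norm_ge0 (MkL2 (sq_integrableB w v)).
  have tl : (t - theta) ^+ 2 <= (e / 2) ^+ 2.
    rewrite -real_normK ?num_real// ler_sqr ?nnegrE ?normr_ge0//.
      by rewrite distrC ltW.
    by rewrite divr_ge0// ltW.
  have wl : L2norm mu (fun x => w x - v x) ^+ 2 <= (e / 2) ^+ 2.
    rewrite ler_sqr ?nnegrE; [exact: ltW|exact: w0|].
    by rewrite divr_ge0// ltW.
  by have := sqr_ge0 e; lra.
have /= := tangent_norm_le _ t _ _ _ w K'0 e0 _ De.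
rewrite lerDl ltW// => /(_ isT) /le_lt_trans; exact.
Qed.

End L2norm.

(** * Moving the base point along a direction, and the associated plan *)

Section transport.
Context {R : realType} {d : nat} {mu : P2vec R d}.
Implicit Types (h s a : R) (v : L2 mu).

Lemma sqn_subidD h v (x : 'cV[R]_d) : sqn (idD h v x - x) = h ^+ 2 * sqn (v x).
Proof. by rewrite /idD addrC addKr sqnZ. Qed.

Lemma measurable_sqnB : measurable_fun setT
  (fun z : 'cV[R]_d * 'cV[R]_d => (sqn (z.1 - z.2))%:E).
Proof.
apply/measurable_EFinP; apply: (measurableT_comp measurable_sqn).
apply: measurable_mxP => i j; under eq_fun do rewrite !mxE.
by apply: measurable_funB; apply: (measurableT_comp (measurable_coord i j)).
Qed.

Section graph_coupling.
Context (h : R) (v : L2 mu).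

Definition idD_id (x : 'cV[R]_d) : 'cV[R]_d * 'cV[R]_d := (idD h v x, x).

Let measurable_idD_id : measurable_fun setT idD_id.
Proof. by apply: measurable_fun_pair => //; exact: measurable_idD. Qed.

HB.instance Definition _ := isMeasurableFun.Build _ _ _ _ idD_id
  measurable_idD_id.

(** The image of [mu] under [idD_id] is a coupling of cost [h^2 * L2norm mu v ^+ 2], which bounds
    the infimum. *)
Lemma W2_push_idD_le : 0 <= h -> W2 (push_idD h v) mu <= h * L2norm mu v.
Proof.
move=> h0; rewrite -(ger0_norm (mulr_ge0 h0 (L2norm_ge0 v))) -sqrtr_sqr.
rewrite ler_wsqrtr// exprMn.
have le : (ereal_inf [set (\int[pi]_z (sqn (z.1 - z.2))%:E)%E
      | pi in couplings (push_idD h v) mu] <=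
    (h ^+ 2 * L2norm mu v ^+ 2)%:E)%E.
  apply: ereal_inf_lbound; exists (distribution mu idD_id); first by split.
  rewrite ge0_integral_distribution//; last 2 first.
  - exact: measurable_sqnB.
  - by move=> z; rewrite lee_fin sqn_ge0.
  under eq_integral do rewrite /= sqn_subidD EFinM.
  rewrite ge0_integralZl_EFin ?sqr_ge0//; last 2 first.
  - by move=> x _; rewrite lee_fin sqn_ge0.
  - by apply/measurable_EFinP; exact: measurable_sqn_L2.
  by rewrite integral_sqn_L2.
(* [W2] goes through [fine], which is compared only at finite values: the two bounds together make
   the infimum finite. *)
have ge : (0 <= ereal_inf [set (\int[pi]_z (sqn (z.1 - z.2))%:E)%E
      | pi in couplings (push_idD h v) mu])%E.
  apply: le_ereal_inf_tmp => _ [pi _ <-]; apply: integral_ge0 => z _.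
  by rewrite lee_fin sqn_ge0.
apply: (@fine_le _ _ (_%:E)) => //.
by rewrite ge0_fin_numE// (le_lt_trans le)// ltry.
Qed.

End graph_coupling.

Lemma dist_push_idD_le h s theta v : 0 <= h ->
  dist (s + h * theta) (push_idD h v) s mu <= h * tangent_norm theta v.
Proof.
move=> h0; rewrite /dist /tangent_norm.
have -> : h * Num.sqrt (theta ^+ 2 + L2norm mu v ^+ 2) =
    Num.sqrt (h ^+ 2 * (theta ^+ 2 + L2norm mu v ^+ 2)).
  by rewrite sqrtrM ?sqr_ge0// sqrtr_sqr ger0_norm.
rewrite ler_wsqrtr// real_normK ?num_real//.
rewrite addrAC subrr add0r mulrDr exprMn lerD2l -exprMn.
by rewrite ler_sqr ?nnegrE ?sqrtr_ge0 ?mulr_ge0 ?sqrtr_ge0// W2_push_idD_le.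
Qed.

(** Both [|theta|] and [L2norm mu v] are at most [tangent_norm theta v], so one smallness condition
    controls time and measure. *)
Lemma domain_push_idD h s r theta v : 0 <= h ->
  h * tangent_norm theta v < r -> domain s mu r (s + h * theta) (push_idD h v).
Proof.
move=> h0 hr.
have hl (y : R) : `|y| <= tangent_norm theta v -> h * `|y| < r.
  by move=> yt; apply: le_lt_trans hr; exact: ler_wpM2l.
have ht : `|theta| <= tangent_norm theta v.
  by rewrite -sqrtr_sqr ler_wsqrtr// lerDl sqr_ge0.
have hv : `|L2norm mu v| <= tangent_norm theta v.
  by rewrite -sqrtr_sqr ler_wsqrtr// lerDr sqr_ge0.
split.
  move: (hl _ ht); rewrite -{1}(ger0_norm h0) -normrM ltr_norml.
  by move=> /andP[? ?]; apply/andP; split; lra.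
apply: le_trans (W2_push_idD_le _ _ h0) _; apply: ltW.
by have := hl _ hv; rewrite ger0_norm// L2norm_ge0.
Qed.

Section plan.
Context {gamma : P2covec R d} (h : R) (v : L2 mu)
  (gmu : measure_eq (distribution gamma fst) mu).
Local Notation XQ := ('cV[R]_d * 'rV[R]_d)%type.

Definition insert_idD (z : XQ) : 'cV[R]_d * 'cV[R]_d * 'rV[R]_d :=
  (z.1, idD h v z.1, z.2).

Let measurable_insert_idD : measurable_fun setT insert_idD.
Proof.
apply: measurable_fun_pair => //; apply: measurable_fun_pair => //.
by apply: measurableT_comp => //; exact: measurable_idD.
Qed.

HB.instance Definition _ := isMeasurableFun.Build _ _ _ _ insert_idD
  measurable_insert_idD.

Let plan_moment : (\int[distribution gamma insert_idD]_z
  (sqn z.1.1 + sqn z.1.2 + sqn z.2)%:E < +oo)%E.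
Proof.
have ms m n : measurable_fun setT (fun A : 'M[R]_(m, n) => (sqn A)%:E).
  by apply/measurable_EFinP; exact: measurable_sqn.
have msh : measurable_fun setT (fun x => (sqn (idD h v x))%:E).
  exact: (measurableT_comp (ms _ _) (measurable_idD h v)).
have s0 m n (A : 'M[R]_(m, n)) : (0 <= (sqn A)%:E)%E.
  by rewrite lee_fin sqn_ge0.
have mm : measurable_fun setT
    (fun z : 'cV[R]_d * 'cV[R]_d * 'rV[R]_d =>
      (sqn z.1.1 + sqn z.1.2 + sqn z.2)%:E).
  apply/measurable_EFinP; apply: measurable_funD; first apply: measurable_funD.
  - apply: (measurableT_comp measurable_sqn).
    exact: (measurableT_comp measurable_fst).
  - apply: (measurableT_comp measurable_sqn).
    exact: (measurableT_comp measurable_snd).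
  - exact: (measurableT_comp measurable_sqn).
rewrite ge0_integral_distribution//; last first.
  by move=> z; rewrite lee_fin !addr_ge0// sqn_ge0.
(* Regrouped as the second moment of [push_idD h v] plus that of [gamma], both already known to be
   finite. *)
rewrite (eq_integral (fun z : XQ => (sqn (idD h v z.1))%:E
    + (sqn z.1 + sqn z.2)%:E)%E); last first.
  by move=> z _; rewrite /= -EFinD; congr EFin; rewrite addrAC addrC.
rewrite ge0_integralD//; last 3 first.
- exact: (measurableT_comp msh).
- by move=> z _; rewrite lee_fin addr_ge0// sqn_ge0.
- apply/measurable_EFinP; apply: measurable_funD;
    exact: (measurableT_comp measurable_sqn).
apply: lte_add_pinfty; last exact: P2_moment.
rewrite (ge0_integral_fst (fun x => (sqn (idD h v x))%:E) gmu)//.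
have := P2_moment (push_idD h v); rewrite ge0_integral_distribution//.
Qed.

Definition idD_plan : P2triple R d := MkP2 plan_moment.

Lemma idD_plan_pr13 : measure_eq (distribution idD_plan pr13) gamma.
Proof.
by move=> C mC; congr (gamma _); apply/seteqP; split=> -[].
Qed.

(** The middle coordinate depends on [x] alone, so its law is the image of the first marginal of
    [gamma], which is [mu]. *)
Lemma idD_plan_pr2 : measure_eq (distribution idD_plan pr2) (push_idD h v).
Proof.
move=> C mC; apply: (gmu (idD h v @^-1` C)).
by rewrite -[X in measurable X]setTI; exact: measurable_idD.
Qed.

Lemma prox_linear_idD_plan (s a theta : R) (k : R.-pker 'cV[R]_d ~> 'rV[R]_d) :
  disintegration gamma k ->
  prox_linear s a (s + h * theta) idD_plan =
  h * (a * theta + pairing mu (barycenter k) v).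
Proof.
move=> hk; rewrite /prox_linear addrAC subrr add0r mulrDr mulrCA; congr +%R.
have intg := integrable_covec_pairing v gmu.
have inth := integrableZl measurableT h intg.
have E (z : XQ) : ((z.2 *m (idD h v z.1 - z.1)) 0 0) = h * (z.2 *m v z.1) 0 0.
  by rewrite /idD [_ + h *: _]addrC addrK -scalemxAr mxE.
rewrite -(integral_covec_pairing v gmu hk) -RintegralZl// /Rintegral.
congr fine; rewrite integral_distribution.
- by apply: eq_integral => z _; rewrite /= E.
- apply/measurable_EFinP; apply: measurable_mulmx00 => //.
  apply: measurable_mxP => i j; under eq_fun do rewrite !mxE.
  apply: measurable_funB; apply: (measurableT_comp (measurable_coord i j)).
    exact: (measurableT_comp measurable_snd measurable_fst).
  exact: (measurableT_comp measurable_fst measurable_fst).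
- by move: inth; congr (integrable _ _ _); apply/funext => z; rewrite /= E.
Qed.

Lemma plan_norm_idD_plan :
  plan_norm (distribution idD_plan pr12) ^+ 2 = h ^+ 2 * L2norm mu v ^+ 2.
Proof.
have s0 m n (A : 'M[R]_(m, n)) : (0 <= (sqn A)%:E)%E.
  by rewrite lee_fin sqn_ge0.
rewrite sqr_sqrtr; last by rewrite fine_ge0// integral_ge0.
(* The real right-hand side is read as [fine] of a finite value, so that the identity can be proved
   in [\bar R]. *)
rewrite /Rintegral; apply: (congr1 fine (y := (_ * _)%:E)).
rewrite ge0_integral_distribution//; last exact: measurable_sqnB.
rewrite ge0_integral_distribution//; last 2 first.
- exact: (measurableT_comp measurable_sqnB measurable_fst).
- by move=> z; exact: s0.
have mv : measurable_fun setT (fun x => (sqn (v x))%:E).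
  by apply/measurable_EFinP; exact: measurable_sqn_L2.
have E (x : 'cV[R]_d) : sqn (x - idD h v x) = h ^+ 2 * sqn (v x).
  by rewrite /idD opprD addNKr -scaleNr sqnZ sqrrN.
under eq_integral do rewrite /= E EFinM.
rewrite ge0_integralZl_EFin ?sqr_ge0//; last exact: (measurableT_comp mv).
by rewrite (ge0_integral_fst (fun x => (sqn (v x))%:E) gmu)// integral_sqn_L2.
Qed.

End plan.

End transport.

(** * Bounds on the difference quotient and passage to the limit *)

Lemma limf_esup_le {T : choiceType} {X : filteredType T} {R : realType}
    (f : X -> \bar R) (F : set (set X)) (c : R) :
  (forall e : R, 0 < e ->
    exists2 V, F V & forall x, V x -> (f x <= (c + e)%:E)%E) ->
  (limf_esup f F <= c%:E)%E.
Proof.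
move=> Fc; rewrite limf_esupE; apply/lee_addgt0Pr => e e0.
have [V FV fV] := Fc e e0.
(* The upper limit is an infimum over the members of [F], so the single [V] bounds it. *)
apply: (@le_trans _ _ (ereal_sup (f @` V))).
  by apply: ereal_inf_lbound; exists V.
by apply: ge_ereal_sup => _ [x /fV fx <-].
Qed.

Section directional.
Context {R : realType} {d : nat} {mu : P2vec R d}.

(** Bounds the proximal error of the transported plan after division by [h]: the quadratic term
    keeps one factor [h], the distance term none. *)
Definition quotient_error (eps sigma h theta : R) (v : L2 mu) : R :=
  sigma * h * tangent_norm theta v ^+ 2 + eps * tangent_norm theta v.

(** Near [(theta, v)] the norm stays below some [K] just above its value there; [h] is then taken
    small in terms of [K]. Each of the two error terms is allowed an excess of [e / 2]. *)
Lemma quotient_error_near (eps sigma alpha e theta : R) (v : L2 mu) :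
  0 <= eps -> 0 <= sigma -> 0 < alpha -> 0 < e ->
  \forall z \near filter_prod (0 : R)^'+ (nbhs (theta, v)),
    [/\ 0 < z.1, z.1 * tangent_norm z.2.1 z.2.2 < alpha &
        quotient_error eps sigma z.1 z.2.1 z.2.2 <=
        eps * tangent_norm theta v + e].
Proof.
move=> eps0 sigma0 alpha0 e0; set N := tangent_norm theta v.
have N0 : 0 <= N by exact: sqrtr_ge0.
have [K [NK K0 Ke]] : exists K, [/\ N < K, 0 < K & eps * K <= eps * N + e / 2].
  have e1 : 0 < eps + 1 by rewrite ltr_wpDl.
  (* Dividing by [eps + 1] covers [eps = 0] as well. *)
  exists (N + e / 2 / (eps + 1)); split.
  - by rewrite ltrDl !divr_gt0.
  - by rewrite ltr_wpDl// !divr_gt0.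
  - rewrite mulrDr lerD2l mulrCA ger_pMr ?divr_gt0// ler_pdivrMr// mul1r.
    by rewrite lerDl.
have [c c0 [cK cs]] : exists2 c : R, 0 < c &
    c * K <= alpha /\ sigma * c * K ^+ 2 <= e / 2.
  have s1 : 0 < (sigma + 1) * K ^+ 2 by rewrite mulr_gt0 ?exprn_gt0// ltr_wpDl.
  (* The first entry keeps [h * K] below [alpha], the second keeps [sigma * h * K ^+ 2] below
     [e / 2]; [sigma + 1] avoids a zero divisor. *)
  exists (Num.min (alpha / K) (e / 2 / ((sigma + 1) * K ^+ 2))).
    by rewrite lt_min !divr_gt0.
  split; first by rewrite -ler_pdivlMr// ge_min lexx.
  apply: (@le_trans _ _
    ((e / 2 / ((sigma + 1) * K ^+ 2)) * ((sigma + 1) * K ^+ 2))).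
    rewrite mulrAC mulrC ler_pM//.
    - by rewrite le_min !divr_ge0 ?mulr_ge0 ?sqr_ge0 ?addr_ge0// ltW.
    - by rewrite mulr_ge0 ?sqr_ge0.
    - by rewrite ge_min lexx orbT.
    - by rewrite ler_wpM2r ?sqr_ge0// lerDl.
  by rewrite divfK// gt_eqF.
exists ([set h : R | 0 < h < c],
  [set z : R * L2 mu | tangent_norm z.1 z.2 < K]).
  split => /=; last exact: tangent_norm_near.
  near=> h; apply/andP.
  by split; near: h; [exact: nbhs_right_gt|exact: nbhs_right_lt].
move=> [h [t w]] /= [/andP[h0 hc] wK].
have t0 : 0 <= tangent_norm t w by exact: sqrtr_ge0.
split=> //.
  by apply: lt_le_trans cK; apply: ltr_pM => //; exact: ltW.
have : quotient_error eps sigma h t w <= sigma * c * K ^+ 2 + eps * K.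
  apply: lerD; last by rewrite ler_wpM2l// ltW.
  apply: ler_pM; rewrite ?mulr_ge0 ?sqr_ge0//; [exact: ltW| |].
    by rewrite ler_wpM2l// ltW.
  by rewrite ler_sqr ?nnegrE// ltW.
lra.
Unshelve. all: by end_near.
Qed.

Section bounds.
Context {phi : R -> P2vec R d -> \bar R} {s r eps a alpha sigma : R}
  {gamma : P2covec R d} {k : R.-pker 'cV[R]_d ~> 'rV[R]_d}.

(** The quadratic terms are equal, because the plan displaces [x] by exactly [h *: v x]; the
    inequality comes from the distance term. *)
Lemma prox_error_idD_plan (h theta : R) (v : L2 mu)
    (gmu : measure_eq (distribution gamma fst) mu) : 0 <= eps -> 0 < h ->
  prox_error s mu eps sigma (s + h * theta) (push_idD h v) (idD_plan h v gmu) <=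
  h * quotient_error eps sigma h theta v.
Proof.
move=> eps0 h0; rewrite /prox_error plan_norm_idD_plan /quotient_error.
rewrite [leRHS]mulrDr; apply: lerD.
  rewrite addrAC subrr add0r.
  rewrite [tangent_norm _ _ ^+ 2]sqr_sqrtr ?addr_ge0 ?sqr_ge0//.
  by rewrite le_eqVlt; apply/orP; left; apply/eqP; ring.
by rewrite mulrCA ler_wpM2l// dist_push_idD_le// ltW.
Qed.

Lemma le_diff_quotient (h theta : R) (v : L2 mu) :
  measure_eq (distribution gamma fst) mu -> disintegration gamma k ->
  0 <= eps -> 0 < alpha <= r -> 0 < h -> h * tangent_norm theta v < alpha ->
  (forall t nu, dist t nu s mu <= alpha -> domain s mu r t nu ->
      forall beta : P2triple R d,
        measure_eq (distribution beta pr13) gamma ->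
        measure_eq (distribution beta pr2) nu ->
        ((prox_linear s a t beta - prox_error s mu eps sigma t nu beta)%:E
         <= phi t nu - phi s mu)%E) ->
  ((- quotient_error eps sigma h theta v)%:E <=
   diff_quotient phi s a (barycenter k) (h, (theta, v)))%E.
Proof.
move=> gmu hk eps0 /andP[alpha0 ar] h0 ha H.
have := H (s + h * theta) (push_idD h v) _ _ (idD_plan h v gmu)
  (idD_plan_pr13 _ _ gmu) (idD_plan_pr2 _ _ gmu).
rewrite (prox_linear_idD_plan _ _ _ _ _ _ k)// => {}H.
(* [phi] may be infinite at the moved point, so only real quantities change sides. *)
rewrite /diff_quotient lee_pdivlMl// leeBrDr// -EFinM -EFinD.
apply: le_trans (H _ _); last 2 first.
- by apply: le_trans (ltW ha); exact/dist_push_idD_le/ltW.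
- by apply: domain_push_idD; [exact: ltW|exact: lt_le_trans ar].
have := prox_error_idD_plan h theta v gmu eps0 h0.
by rewrite lee_fin; lra.
Qed.

Lemma ge_diff_quotient (h theta : R) (v : L2 mu) :
  measure_eq (distribution gamma fst) mu -> disintegration gamma k ->
  0 <= eps -> 0 < alpha <= r -> 0 < h -> h * tangent_norm theta v < alpha ->
  (forall t nu, dist t nu s mu <= alpha -> domain s mu r t nu ->
      forall beta : P2triple R d,
        measure_eq (distribution beta pr13) gamma ->
        measure_eq (distribution beta pr2) nu ->
        (phi t nu - phi s mu <=
         (prox_linear s a t beta
          + prox_error s mu eps sigma t nu beta)%:E)%E) ->
  (diff_quotient phi s a (barycenter k) (h, (theta, v)) <=
   (quotient_error eps sigma h theta v)%:E)%E.
Proof.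
move=> gmu hk eps0 /andP[alpha0 ar] h0 ha H.
have := H (s + h * theta) (push_idD h v) _ _ (idD_plan h v gmu)
  (idD_plan_pr13 _ _ gmu) (idD_plan_pr2 _ _ gmu).
rewrite (prox_linear_idD_plan _ _ _ _ _ _ k)// => {}H.
rewrite /diff_quotient lee_pdivrMl// leeBlDr// -EFinM -EFinD.
apply: le_trans (H _ _) _.
- by apply: le_trans (ltW ha); exact/dist_push_idD_le/ltW.
- by apply: domain_push_idD; [exact: ltW|exact: lt_le_trans ar].
have := prox_error_idD_plan h theta v gmu eps0 h0.
by rewrite lee_fin; lra.
Qed.

End bounds.
End directional.

Theorem proposition3p4 (R : realType) (d : nat) (T s r eps : R)
    (mu : P2vec R d) (phi : R -> P2vec R d -> \bar R)
    (hs : 0 < s < T) (hr : 0 < r) (heps : 0 <= eps)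
    (hphi : phi s mu \is a fin_num)
    (a : R) (gamma : P2covec R d) (k : R.-pker 'cV[R]_d ~> 'rV[R]_d)
    (hk : disintegration gamma k) :
  (subdiffP phi s mu r eps (a, gamma) ->
   subdiffD phi s mu eps (a, barycenter k)) /\
  (superdiffP phi s mu r eps (a, gamma) ->
   superdiffD phi s mu eps (a, barycenter k)).
Proof.
split=> -[/= gmu [alpha [sigma [ar sigma0 H]]]].
  split=> [|theta v]; first exact: (sq_integrable_barycenter gmu hk).
  (* A lower limit is minus the upper limit of the opposite function, so the lower case also reduces
     to [limf_esup_le]. *)
  rewrite /limf_einf EFinN leeN2; apply: limf_esup_le => e e0.
  have [alpha0 _] := andP ar.
  have FV :=
    quotient_error_near eps sigma alpha e theta v heps sigma0 alpha0 e0.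
  eexists; first exact: FV.
  move=> [h [t w]] /= [h0 ha he].
  rewrite leeNl -EFinN.
  apply: le_trans (le_diff_quotient h t w gmu hk _ ar _ _ H) => //.
  by rewrite lee_fin lerN2.
split=> [|theta v]; first exact: (sq_integrable_barycenter gmu hk).
apply: limf_esup_le => e e0; have [alpha0 _] := andP ar.
have FV := quotient_error_near eps sigma alpha e theta v heps sigma0 alpha0 e0.
eexists; first exact: FV.
move=> [h [t w]] /= [h0 ha he].
by apply: (le_trans (ge_diff_quotient h t w gmu hk _ ar _ _ H)).
Qed.
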